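(* For every integer $\ell\ge 1$, the following identities of power series in $q$ hold: \[ \sum_{n=0}^{\infty}\overline{p}_{2\ell}(2n)q^n=\frac{f_{2\ell}f_4^5}{f_{\ell}^2f_1^4f_{8}^2}=\frac{\varphi(q^2)}{\varphi(-q^\ell)\varphi(-q)^2}, \] \[ \sum_{n=0}^{\infty}\overline{p}_{2\ell}(2n+1)q^n=2\,\frac{f_{2\ell}f_2^2f_{8}^2}{f_{\ell}^2f_1^4f_4}=2\,\frac{\psi(q^4)}{\varphi(-q^\ell)\varphi(-q)^2}, \] \[ \sum_{n=0}^{\infty}\overline{p}_{3\ell}(3n)q^n=\frac{f_{2\ell}f_2^4f_3^6}{f_{\ell}^2f_1^8f_{6}^3}=\frac{\varphi(-q^3)^3}{\varphi(-q^\ell)\varphi(-q)^4}, \] \[ \sum_{n=0}^{\infty}\overline{p}_{3\ell}(3n+1)q^n=2\,\frac{f_{2\ell}f_2^3f_3^3}{f_{\ell}^2f_1^7}, \] \[ \sum_{n=0}^{\infty}\overline{p}_{3\ell}(3n+2)q^n=4\,\frac{f_{2\ell}f_2^2f_{6}^3}{f_{\ell}^2f_1^6}. \]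
   Context: For $k\ge1$ let $f_k=\prod_{m\ge1}(1-q^{km})$, with $|q|<1$ (equivalently, as formal power series in $q$). For an integer $\ell\ge1$, $\overline{p}_\ell(n)$ denotes the number of 2-color overpartitions of $n$ (the first occurrence of a part of each color may be overlined) in which one of the two colors appears only in parts that are multiples of $\ell$; its generating function is $\sum_{n\ge0}\overline{p}_\ell(n)q^n=\dfrac{f_2f_{2\ell}}{f_1^2f_\ell^2}$. Ramanujan's theta functions are $\varphi(q)=\sum_{n\in\mathbb Z}q^{n^2}=\dfrac{f_2^5}{f_1^2f_4^2}$ and $\psi(q)=\sum_{n\ge0}q^{n(n+1)/2}=\dfrac{f_2^2}{f_1}$; thus $\varphi(-q^\ell)=\sum_{n\in\mathbb Z}(-1)^nq^{\ell n^2}=f_\ell^2/f_{2\ell}$, where $-q^\ell$ means $-(q^\ell)$. *)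

(* Defs.v *)
From HB Require Import structures.
From mathcomp Require Import all_boot all_order all_algebra.
From mathcomp Require Import boolp.

Set Implicit Arguments.
Unset Strict Implicit.
Unset Printing Implicit Defensive.
Import GRing.Theory.
Local Open Scope ring_scope.

(** * Formal power series in one variable [q] *)

Record fps (R : Type) := Fps { fpscoef : nat -> R }.

Notation "\fps_ n E" := (Fps (fun n : nat => E))
  (at level 36, n name, E at level 36, format "\fps_ n  E") : ring_scope.

Lemma fpsP (R : Type) (a b : fps R) : fpscoef a =1 fpscoef b <-> a = b.
Proof. by split=> [|-> //]; case: a b => a [b] /= /funext->. Qed.

HB.instance Definition _ (R : Type) := gen_eqMixin (fps R).
HB.instance Definition _ (R : Type) := gen_choiceMixin (fps R).

Section FpsZmodule.
Variable R : zmodType.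
Implicit Types a b c : fps R.

Definition fps_zero : fps R := \fps_n 0.
Definition fps_opp a : fps R := \fps_n (- fpscoef a n).
Definition fps_add a b : fps R := \fps_n (fpscoef a n + fpscoef b n).

Fact fps_addA : associative fps_add.
Proof. by move=> a b c; apply/fpsP => n /=; rewrite addrA. Qed.
Fact fps_addC : commutative fps_add.
Proof. by move=> a b; apply/fpsP => n /=; rewrite addrC. Qed.
Fact fps_add0 : left_id fps_zero fps_add.
Proof. by move=> a; apply/fpsP => n /=; rewrite add0r. Qed.
Fact fps_addN : left_inverse fps_zero fps_opp fps_add.
Proof. by move=> a; apply/fpsP => n /=; rewrite addNr. Qed.

HB.instance Definition _ :=
  GRing.isZmodule.Build (fps R) fps_addA fps_addC fps_add0 fps_addN.

Lemma fpscoef0 n : fpscoef (0 : fps R) n = 0. Proof. by []. Qed.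
Lemma fpscoefN a n : fpscoef (- a) n = - fpscoef a n. Proof. by []. Qed.
Lemma fpscoefD a b n : fpscoef (a + b) n = fpscoef a n + fpscoef b n.
Proof. by []. Qed.
Lemma fpscoef_sum (I : Type) (r : seq I) (P : pred I) (F : I -> fps R) n :
  fpscoef (\sum_(i <- r | P i) F i) n = \sum_(i <- r | P i) fpscoef (F i) n.
Proof. by elim/big_rec2: _ => [//|i x y _ <-]. Qed.

End FpsZmodule.

Section FpsRing.
Variable R : comNzRingType.
Implicit Types a b c : fps R.

Definition fps_one : fps R := \fps_n (n == 0%N)%:R.
Definition fps_mul a b : fps R :=
  \fps_n (\sum_(i < n.+1) fpscoef a i * fpscoef b (n - i)).

(* Products of series are computed on truncations, so the ring laws come from
   those of polynomials. *)
Definition fps_trunc N a : {poly R} := \poly_(i < N) fpscoef a i.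

Fact fps_mul_trunc N a b n : (n < N)%N ->
  fpscoef (fps_mul a b) n = (fps_trunc N a * fps_trunc N b)`_n.
Proof.
move=> ltnN; rewrite coefM /=; apply: eq_bigr => i _; rewrite !coef_poly.
by rewrite (leq_ltn_trans (leq_subr _ _)) ?(leq_ltn_trans (leq_ord i)).
Qed.

Fact fps_mulC : commutative fps_mul.
Proof. by move=> a b; apply/fpsP => n; rewrite !(@fps_mul_trunc n.+1) // mulrC. Qed.

Fact fps_mulA : associative fps_mul.
Proof.
move=> a b c; apply/fpsP => n.
pose T := fps_trunc n.+1.
have -> : fpscoef (fps_mul a (fps_mul b c)) n = (T a * (T b * T c))`_n.
  rewrite coefM /=; apply: eq_bigr => i _; rewrite coef_poly ltn_ord.
  by rewrite -fps_mul_trunc // ltnS leq_subr.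
rewrite mulrA coefM /=; apply: eq_bigr => i _.
by rewrite -fps_mul_trunc // coef_poly ltnS leq_subr.
Qed.

Fact fps_mul1 : left_id fps_one fps_mul.
Proof.
move=> a; apply/fpsP => n /=.
by rewrite big_ord_recl /= mul1r subn0 big1 ?addr0 // => i _; rewrite mul0r.
Qed.

Fact fps_mulDl : left_distributive fps_mul +%R.
Proof.
move=> a b c; apply/fpsP => n /=; rewrite -big_split /=.
by apply: eq_bigr => i _; rewrite mulrDl.
Qed.

Fact fps_one_neq0 : fps_one != 0.
Proof. by apply/eqP => /fpsP/(_ 0%N)/= /eqP; rewrite oner_eq0. Qed.

HB.instance Definition _ := GRing.Zmodule_isComNzRing.Build (fps R)
  fps_mulA fps_mulC fps_mul1 fps_mulDl fps_one_neq0.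

Lemma fpscoef1 n : fpscoef (1 : fps R) n = (n == 0%N)%:R. Proof. by []. Qed.
Lemma fpscoefM a b n :
  fpscoef (a * b) n = \sum_(i < n.+1) fpscoef a i * fpscoef b (n - i).
Proof. by []. Qed.

Lemma fpscoefX_small a j n :
  fpscoef a 0 = 0 -> (n < j)%N -> fpscoef (a ^+ j) n = 0.
Proof.
move=> a0; elim: j n => [//|j IHj] n ltnj; rewrite exprS fpscoefM big1 // => i _.
case: (posnP i) => [->|i_gt0]; first by rewrite a0 mul0r.
rewrite IHj ?mulr0 //; case: n ltnj i i_gt0 => [|n] ltnj i i_gt0.
  by case: i i_gt0 => -[].
by rewrite -(prednK i_gt0) subSS (leq_ltn_trans (leq_subr _ _)).
Qed.

End FpsRing.

Section FpsUnitRing.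
Variable R : comUnitRingType.
Implicit Types a b : fps R.

Definition fps_unit : {pred fps R} :=
  fun a => fpscoef a 0 \is a GRing.unit.

(* If [a = a_0 (1 - u)] then [a^-1] is the geometric series [a_0^-1 \sum_j u^j],
   in which only the terms with [j <= n] contribute to degree [n]. *)
Definition fps_geo a : fps R :=
  1 - \fps_n ((fpscoef a 0)^-1 * fpscoef a n).
Definition fps_inv a : fps R :=
  if a \in fps_unit then
    \fps_n ((fpscoef a 0)^-1 * \sum_(j < n.+1) fpscoef (fps_geo a ^+ j) n)
  else a.

Fact fps_mulV : {in fps_unit, left_inverse 1 fps_inv *%R}.
Proof.
move=> a ua; rewrite /fps_inv ua; apply/fpsP => n.
have u0 : fpscoef (fps_geo a) 0 = 0 by rewrite fpscoefD fpscoefN /= mulVr ?subrr.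
have <- : fpscoef ((\sum_(j < n.+1) fps_geo a ^+ j) * (1 - fps_geo a)) n
         = fpscoef (1 : fps R) n.
  rewrite mulrC -opprB mulNr -subrX1 opprB fpscoefD fpscoefN.
  by rewrite fpscoefX_small ?subr0.
rewrite !fpscoefM; apply: eq_bigr => i _.
have -> : fpscoef (1 - fps_geo a) (n - i) = (fpscoef a 0)^-1 * fpscoef a (n - i).
  by rewrite /fps_geo subKr.
rewrite /= mulrCA mulrA; congr (_ * _ * _).
rewrite fpscoef_sum -!(big_mkord xpredT (fun j => fpscoef (fps_geo a ^+ j) i)).
rewrite [RHS](@big_cat_nat _ _ _ i.+1) //= -[LHS]addr0; congr (_ + _).
by rewrite big_nat big1 // => j /andP[ltij _]; rewrite fpscoefX_small.
Qed.

Fact fps_unitPl a b : b * a = 1 -> fps_unit a.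
Proof.
move/fpsP/(_ 0%N); rewrite fpscoefM big_ord_recl big_ord0 addr0 /= => ba1.
by apply/unitrPr; exists (fpscoef b 0); rewrite mulrC.
Qed.

Fact fps_inv_out : {in [predC fps_unit], fps_inv =1 id}.
Proof. by move=> a /negPf ua; rewrite /fps_inv ua. Qed.

HB.instance Definition _ := GRing.ComNzRing_hasMulInverse.Build (fps R)
  fps_mulV fps_unitPl fps_inv_out.

Lemma fps_unitE a : (a \is a GRing.unit) = (fpscoef a 0 \is a GRing.unit).
Proof. by []. Qed.

End FpsUnitRing.

(* [fps_subst c k F] is [F (c q^k)], for [0 < k]. *)
Definition fps_subst (R : comNzRingType) (c : R) (k : nat) (F : fps R) : fps R :=
  \fps_n (if (k %| n)%N then c ^+ (n %/ k) * fpscoef F (n %/ k) else 0).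

(** * Eta products and theta functions *)

(* [\prod_(m >= 1) (1 - q^(k m))] for [0 < k]: the factors with [m > n] do not
   contribute to degree [n]. *)
Definition eta (k : nat) : fps int :=
  \fps_n ((\prod_(1 <= m < n.+1) (1 - 'X^(k * m)) : {poly int})`_n).

(* [\sum_(m in Z) q^(m^2)]: the coefficient of [q^n] is the number of integers
   [m] with [m^2 = n]; these satisfy [|m| <= n] and are enumerated as [i - n]
   with [0 <= i <= 2n]. *)
Definition phi : fps int :=
  \fps_n (#|[set i : 'I_(n.*2.+1) | (i%:Z - n%:Z) ^+ 2 == n%:Z]|%:Z).

(* [\sum_(m >= 0) q^(m(m+1)/2)]: any [m] with [m(m+1)/2 = n] is at most [n]. *)
Definition psi : fps int :=
  \fps_n (#|[set m : 'I_n.+1 | (m * m.+1)./2 == n]|%:Z).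

Lemma eta_unit k : eta k \is a GRing.unit.
Proof. by rewrite fps_unitE /= big_geq // coef1. Qed.

Lemma phi_subst_unit c k : fps_subst c k phi \is a GRing.unit.
Proof.
rewrite fps_unitE /= dvdn0 div0n expr0 mul1r.
suff -> : [set i : 'I_1 | (i%:Z - 0) ^+ 2 == 0] = setT by rewrite cardsT card_ord.
by apply/setP => i; rewrite !inE ord1.
Qed.

(** * Overpartitions *)

(* A two-coloured overpartition with all parts of size at most [n] is given by
   the multiplicity of each part, together with the set of the parts whose first
   occurrence is overlined. The pair [(c, i)] stands for the part of size [i + 1]
   and colour [c]; the colour [true] is the one restricted to multiples of [l]. *)
Definition is_overpartition (l n : nat)
    (p : {ffun bool * 'I_n -> 'I_n.+1} * {set bool * 'I_n}) : bool :=
  let: (mult, over) := p in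
  [&& (\sum_(x : bool * 'I_n) mult x * x.2.+1 == n)%N,
      [forall x in over, 0 < mult x]%N
    & [forall i : 'I_n, (0 < mult (true, i)) ==> (l %| i.+1)]%N].

Definition pbar (l n : nat) : nat := #|[set p | @is_overpartition l n p]|.

(* Main.v *)
(** Write [phi_k = phi(-q^k) = f_k^2 / f_(2k)], so that the generating function
    of the [pbar l n] is [1 / (phi_1 phi_l)]. For the modulus 2,
    [phi(q) phi(-q) = phi_2^2] and [phi(q) = phi(q^4) + 2 q psi(q^8)] give
    [1 / phi_1 = (phi(q^4) + 2 q psi(q^8)) / phi_2^2]. For the modulus 3,
    [phi_1 = a - 2 q w] where [a = phi_9] and [w] are series in [q^3]; hence
    [1 / phi_1 = (a^2 + 2 q a w + 4 q^2 w^2) / (a^3 - 8 q^3 w^3)], whose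
    denominator is the product of the [phi(-z q)] over the cube roots of unity
    [z], and is computed from [f_1(q) f_1(z q) f_1(z^2 q) = f_3^4 / f_9].
    The product formulas for [phi], [psi] and [w] are instances of the Jacobi
    triple product, obtained as the [q]-adic limit of its finite form. *)
From HB Require Import structures.
Require Import Defs.
From mathcomp Require Import all_boot all_order all_algebra all_field.
From mathcomp Require Import ring zify.
Set Implicit Arguments.
Unset Strict Implicit.
Unset Printing Implicit Defensive.
Import GRing.Theory.
Local Open Scope ring_scope.

(** * q-adic convergence *)

Section Convergence.
Variable R : comNzRingType.
Implicit Types (a b c d : fps R) (u v : nat -> fps R).

Definition eqm D a b := forall n, (n < D)%N -> fpscoef a n = fpscoef b n.

Lemma eqm_refl D a : eqm D a a. Proof. by []. Qed.
Lemma eqm_sym D a b : eqm D a b -> eqm D b a.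
Proof. by move=> ab n /ab. Qed.
Lemma eqm_trans D b a c : eqm D a b -> eqm D b c -> eqm D a c.
Proof. by move=> ab bc n nD; rewrite ab ?bc. Qed.
Lemma eqmW D D' a b : (D' <= D)%N -> eqm D a b -> eqm D' a b.
Proof. by move=> leD ab n nD; rewrite ab ?(leq_trans nD). Qed.
Lemma eqmD D a b c d : eqm D a b -> eqm D c d -> eqm D (a + c) (b + d).
Proof. by move=> ab cd n nD; rewrite !fpscoefD ab ?cd. Qed.
Lemma eqmM D a b c d : eqm D a b -> eqm D c d -> eqm D (a * c) (b * d).
Proof.
move=> ab cd n nD; rewrite !fpscoefM; apply: eq_bigr => i _.
by rewrite ab ?cd // (leq_ltn_trans _ nD) ?leq_subr // -ltnS.
Qed.
Lemma eqmX D a b k : eqm D a b -> eqm D (a ^+ k) (b ^+ k).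
Proof. by move=> ab; elim: k => [|k IHk] //; rewrite !exprS; apply: eqmM. Qed.
Lemma eqmN D a b : eqm D a b -> eqm D (- a) (- b).
Proof. by move=> ab n nD; rewrite !fpscoefN ab. Qed.
Lemma eqm_sum (I : Type) (r : seq I) (P : pred I) D (F G : I -> fps R) :
  (forall i, P i -> eqm D (F i) (G i)) ->
  eqm D (\sum_(i <- r | P i) F i) (\sum_(i <- r | P i) G i).
Proof. by move=> FG; elim/big_rec2: _ => // i a b /FG; apply: eqmD. Qed.
Lemma eqm_prod (I : Type) (r : seq I) (P : pred I) D (F G : I -> fps R) :
  (forall i, P i -> eqm D (F i) (G i)) ->
  eqm D (\prod_(i <- r | P i) F i) (\prod_(i <- r | P i) G i).
Proof. by move=> FG; elim/big_rec2: _ => // i a b /FG; apply: eqmM. Qed.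

Lemma eqm_prod1 (I : Type) (r : seq I) (P : pred I) D (F : I -> fps R) :
  (forall i, P i -> eqm D (F i) 1) -> eqm D (\prod_(i <- r | P i) F i) 1.
Proof.
move=> F1; apply: eqm_trans (eqm_prod r F1) _.
by rewrite big1_eq.
Qed.
Lemma eqm_expr0 D a j : fpscoef a 0 = 0 -> (D <= j)%N -> eqm D (a ^+ j) 0.
Proof. by move=> a0 Dj n nD; rewrite fpscoefX_small ?(leq_trans nD). Qed.

Definition conv u a :=
  forall D, exists N0, forall N, (N0 <= N)%N -> eqm D (u N) a.

Lemma conv_uniq u a b : conv u a -> conv u b -> a = b.
Proof.
move=> ua ub; apply/fpsP => n.
have [M Ma] := ua n.+1; have [M' Mb] := ub n.+1.
by rewrite -(Ma (maxn M M')) ?leq_maxl // (Mb (maxn M M')) ?leq_maxr.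
Qed.

Lemma eq_conv u v a : u =1 v -> conv u a -> conv v a.
Proof. by move=> uv ua D; have [M Ma] := ua D; exists M => N /Ma; rewrite uv. Qed.

Lemma conv_cst a : conv (fun=> a) a. Proof. by move=> D; exists 0%N. Qed.

Lemma convD u v a b : conv u a -> conv v b -> conv (fun N => u N + v N) (a + b).
Proof.
move=> ua vb D; have [M Ma] := ua D; have [M' Mb] := vb D.
exists (maxn M M') => N; rewrite geq_max => /andP[/Ma ? /Mb ?].
exact: eqmD.
Qed.

Lemma convM u v a b : conv u a -> conv v b -> conv (fun N => u N * v N) (a * b).
Proof.
move=> ua vb D; have [M Ma] := ua D; have [M' Mb] := vb D.
exists (maxn M M') => N; rewrite geq_max => /andP[/Ma ? /Mb ?].
exact: eqmM.
Qed.

Lemma convX u a k : conv u a -> conv (fun N => u N ^+ k) (a ^+ k).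
Proof.
by move=> ua D; have [M Ma] := ua D; exists M => N /Ma; apply: eqmX.
Qed.

Lemma conv_scale k u a : (0 < k)%N -> conv u a -> conv (fun N => u (k * N)%N) a.
Proof.
move=> k0 ua D; have [M Ma] := ua D; exists M => N MN.
by apply: Ma; rewrite (leq_trans MN) ?leq_pmull.
Qed.

End Convergence.

Lemma eqmV (R : comUnitRingType) D (a b : fps R) :
  a \is a GRing.unit -> b \is a GRing.unit -> eqm D a b -> eqm D a^-1 b^-1.
Proof.
move=> aU bU ab; rewrite -[a^-1](mulrK bU) -[X in eqm _ _ X]mul1r -(mulVr aU).
by apply: eqmM => //; apply: eqmM => //; apply: eqm_sym.
Qed.

(** Folds a sum about its middle: positions [N + i] and [N - i.+1] stand for the integers [i] and
    [-(i + 1)] of a bilateral sum. *)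
Lemma sum_centered (V : nmodType) (G : nat -> V) N :
  \sum_(k < N + N) G k = \sum_(i < N) (G (N + i)%N + G (N - i.+1)%N).
Proof.
rewrite big_split_ord /= addrC big_split /=; congr (_ + _).
by rewrite [LHS](reindex_inj rev_ord_inj).
Qed.

(** Product formulas hold at each finite stage in cross-multiplied form; only the limiting
    denominator [b] has to be inverted. *)
Lemma conv_div (R : comUnitRingType) (u v w : nat -> fps R) a b :
    b \is a GRing.unit -> (forall N, u N * v N = w N) ->
  conv v b -> conv w a -> conv u (a / b).
Proof.
move=> bU uv vb wa D; have [M Ma] := wa D; have [M' Mb] := vb D.
exists (maxn M M') => N; rewrite geq_max => /andP[/Ma wN /Mb vN].
rewrite -[u N](mulrK bU); apply: eqmM => //; apply: eqm_trans wN.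
by rewrite -uv; apply: eqmM => //; apply: eqm_sym.
Qed.

(** * Substitution of [c q^k] for [q] *)

Section Substitution.
Variable R : comNzRingType.

Definition fps_of_poly (p : {poly R}) : fps R := \fps_n p`_n.

Fact fps_of_poly_is_zmod_morphism : zmod_morphism fps_of_poly.
Proof. by move=> p r; apply/fpsP => n; rewrite /= coefB. Qed.
Fact fps_of_poly_is_monoid_morphism : monoid_morphism fps_of_poly.
Proof.
split=> [|p r]; apply/fpsP => n /=; first by rewrite coef1.
by rewrite coefM.
Qed.
HB.instance Definition _ := GRing.isZmodMorphism.Build {poly R} (fps R)
  fps_of_poly fps_of_poly_is_zmod_morphism.
HB.instance Definition _ := GRing.isMonoidMorphism.Build {poly R} (fps R)
  fps_of_poly fps_of_poly_is_monoid_morphism.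

Definition fpsX : fps R := fps_of_poly 'X.

Lemma fpscoefXn k n : fpscoef (fpsX ^+ k) n = (n == k)%:R.
Proof. by rewrite -rmorphXn /= coefXn. Qed.

Lemma fpscoefXnM k a n :
  fpscoef (fpsX ^+ k * a) n = if (n < k)%N then 0 else fpscoef a (n - k).
Proof.
rewrite fpscoefM; case: ltnP => [nk|kn].
  rewrite big1 // => i _; rewrite fpscoefXn.
  by rewrite (ltn_eqF (leq_ltn_trans _ nk)) ?mul0r // -ltnS.
have kn1 : (k < n.+1)%N by [].
rewrite (bigD1 (Ordinal kn1)) //= fpscoefXn eqxx mul1r big1 ?addr0 // => i.
by rewrite fpscoefXn -val_eqE /= => /negPf->; rewrite mul0r.
Qed.

Lemma eqm_trunc N (F : fps R) : eqm N F (fps_of_poly (fps_trunc N F)).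
Proof. by move=> n nN; rewrite /= coef_poly nN. Qed.

Lemma eqm_subst D (c : R) k F G : (0 < k)%N ->
  eqm D F G -> eqm D (fps_subst c k F) (fps_subst c k G).
Proof.
move=> k0 FG n nD /=; case: ifP => // _.
by rewrite FG // (leq_ltn_trans (leq_div _ _)).
Qed.

Lemma fps_subst_poly (c : R) k p : (0 < k)%N ->
  fps_subst c k (fps_of_poly p) = fps_of_poly (p \Po (c *: 'X) \Po 'X^k).
Proof.
move=> k0; apply/fpsP => n /=; rewrite coef_comp_poly_Xn //; case: ifP => // _.
rewrite coef_comp_poly.
under eq_bigr => i _ do rewrite exprZn coefZ coefXn.
set m := (n %/ k)%N.
case: (ltnP m (size p)) => [mp|pm].
  rewrite (bigD1 (Ordinal mp)) //= eqxx mulr1 big1 ?addr0 1?mulrC // => i.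
  by rewrite -val_eqE /= eq_sym => /negPf->; rewrite !mulr0.
rewrite nth_default // mulr0 big1 // => i _.
by rewrite gtn_eqF ?mulr0 // (leq_trans _ pm).
Qed.

(** Writing the exponent as [k.+1] builds positivity into the term, so that the morphism structure
    can be inferred. *)
Fact fps_subst_is_zmod_morphism (c : R) k : zmod_morphism (fps_subst c k.+1).
Proof.
move=> F G; apply/fpsP => n; rewrite fpscoefD fpscoefN /=.
by case: ifP; rewrite ?subr0 // mulrBr.
Qed.

(** Coefficient [n] depends only on coefficients of index at most [n], so both factors may be
    truncated to polynomials, where substitution is composition. *)
Fact fps_subst_is_monoid_morphism (c : R) k : monoid_morphism (fps_subst c k.+1).
Proof.
split=> [|F G].
  by rewrite -(rmorph1 fps_of_poly) fps_subst_poly // !rmorph1.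
apply/fpsP => n; pose T H := fps_of_poly (fps_trunc n.+1 H).
have TP H : eqm n.+1 (fps_subst c k.+1 H) (fps_subst c k.+1 (T H)).
  by apply: eqm_subst => //; apply: eqm_trunc.
rewrite (eqmM (TP F) (TP G)) // !fps_subst_poly //.
have -> p r : fps_of_poly (p \Po (c *: 'X) \Po 'X^(k.+1))
      * fps_of_poly (r \Po (c *: 'X) \Po 'X^(k.+1))
    = fps_subst c k.+1 (fps_of_poly p * fps_of_poly r).
  by rewrite -[fps_of_poly p * _]rmorphM fps_subst_poly // !rmorphM.
by apply: eqm_subst (ltnSn n) => //; apply: eqmM; apply: eqm_trunc.
Qed.

HB.instance Definition _ (c : R) k := GRing.isZmodMorphism.Build (fps R) (fps R)
  (@fps_subst R c k.+1) (@fps_subst_is_zmod_morphism c k).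
HB.instance Definition _ (c : R) k := GRing.isMonoidMorphism.Build (fps R) (fps R)
  (@fps_subst R c k.+1) (@fps_subst_is_monoid_morphism c k).

Lemma fps_substX (c : R) k : (0 < k)%N ->
  fps_subst c k fpsX = fps_of_poly c%:P * fpsX ^+ k.
Proof.
by move=> k0; rewrite fps_subst_poly // comp_polyX comp_polyZ comp_polyX -mul_polyC
  -rmorphXn -rmorphM.
Qed.

Lemma fps_subst1X k : (0 < k)%N -> fps_subst (1 : R) k fpsX = fpsX ^+ k.
Proof. by move=> k0; rewrite fps_substX // rmorph1 mul1r. Qed.

Lemma fps_substN1X k : (0 < k)%N -> fps_subst (-1 : R) k fpsX = - fpsX ^+ k.
Proof. by move=> k0; rewrite fps_substX // rmorphN1 rmorphN1 mulN1r. Qed.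

Lemma fps_subst_comp (c d : R) j k F : (0 < j)%N -> (0 < k)%N ->
  fps_subst c k (fps_subst d j F) = fps_subst (d * c ^+ j) (j * k) F.
Proof.
move=> j0 k0; apply/fpsP => n /=.
case: (boolP (k %| n)%N) => [/dvdnP[m ->]|kn].
  rewrite mulnK // dvdn_pmul2r //; case: ifP => [/dvdnP[i ->]|_]; last by rewrite mulr0.
  rewrite mulnK // -mulnA mulnK ?muln_gt0 ?j0 // mulrA exprMn.
  by congr (_ * _); rewrite mulrC mulnC exprM.
by case: ifP => // jn; case/negP: kn; apply: dvdn_trans jn; apply: dvdn_mull.
Qed.

Lemma conv_subst (c : R) k u a : (0 < k)%N -> conv u a ->
  conv (fun N => fps_subst c k (u N)) (fps_subst c k a).
Proof.
by move=> k0 ua D; have [M Ma] := ua D; exists M => N /Ma; apply: eqm_subst.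
Qed.

End Substitution.

(** Coefficient [n] of [eta k] is defined by the first [n] factors; as [0 < k], every later factor
    is [1] modulo [q^(n+1)]. *)
Lemma eta_conv k : (0 < k)%N ->
  conv (fun N => \prod_(i < N) (1 - fpsX _ ^+ (k * i.+1))) (eta k).
Proof.
move=> k0 D; exists D => N DN n nD /=.
have nN : (n <= N)%N by rewrite ltnW // (leq_trans nD).
have -> : (\prod_(1 <= m < n.+1) (1 - 'X^(k * m)) : {poly int})`_n
    = fpscoef (\prod_(i < n) (1 - fpsX int ^+ (k * i.+1))) n.
  have -> : \prod_(i < n) (1 - fpsX int ^+ (k * i.+1))
      = fps_of_poly (\prod_(i < n) (1 - 'X^(k * i.+1))).
    by rewrite rmorph_prod; apply: eq_bigr => i _; rewrite rmorphB rmorph1 rmorphXn.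
  by rewrite /= big_add1 big_mkord.
rewrite -(subnKC nN) big_split_ord /= -[X in _ = fpscoef X n]mulr1.
suff E : eqm n.+1 (\prod_(i < N - n) (1 - fpsX int ^+ (k * (n + i).+1))) 1.
  by apply: (eqmM (@eqm_refl _ n.+1 _) E).
apply: eqm_prod1 => i _ m mn.
rewrite fpscoefD fpscoefN fpscoefXn ltn_eqF ?subr0 //.
by rewrite (leq_trans mn) // (leq_trans _ (leq_pmull _ k0)) // ltnS leq_addr.
Qed.

(** * The Jacobi triple product *)

Section TripleProduct.
Variable R : comUnitRingType.
Variables u v : fps R.
Hypotheses (u0 : fpscoef u 0 = 0) (v0 : fpscoef v 0 = 0).
Let Q := u * v.

Let p n := \prod_(i < n) (1 - Q ^+ i.+1).
Let r n := (p n)^-1.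

Lemma fps_unit_1 (F : fps R) : eqm 1 F 1 -> F \is a GRing.unit.
Proof. by move=> F1; rewrite fps_unitE F1 // unitr1. Qed.

Let Q0 : fpscoef Q 0 = 0.
Proof. by rewrite fpscoefM big_ord_recl big_ord0 addr0 u0 mul0r. Qed.

Let factor_unit i : 1 - Q ^+ i.+1 \is a GRing.unit.
Proof.
apply: fps_unit_1 => -[|] // _.
by rewrite fpscoefD fpscoefN (fpscoefX_small Q0) // subr0.
Qed.

Let p_unit n : p n \is a GRing.unit.
Proof.
elim: n => [|n IHn]; rewrite /p ?big_ord0 ?unitr1 // big_ord_recr /=.
by rewrite unitrM IHn factor_unit.
Qed.

Let rS n : r n = r n.+1 * (1 - Q ^+ n.+1).
Proof.
by rewrite [in RHS]/r [p n.+1]/p big_ord_recr /= -/(p n) invrM // mulrAC mulVr // mul1r.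
Qed.

(** Here [p n] is the Pochhammer symbol [(Q; Q)_n], so [p n * S n s] is the sum of the [s k]
    weighted by Gaussian binomials in [Q]. *)
Let S n (s : nat -> fps R) := \sum_(k < n.+1) r k * r (n - k) * s k.

(* One step of the finite triple product: multiplying by a further factor
   shifts the terms, and the two contributions recombine through
   [1 - Q^(n+1) = (1 - Q^(n+1-k)) + Q^(n+1-k) (1 - Q^k)] (the [q]-Pascal rule). *)
Let S_step n s w :
    (forall k, (k <= n)%N -> s k * w = s k.+1 * Q ^+ (n - k)) ->
  S n s * (1 + w) = (1 - Q ^+ n.+1) * S n.+1 s.
Proof.
move=> sw.
have -> : (1 - Q ^+ n.+1) * S n.+1 s
    = \sum_(k < n.+2) r k * r (n.+1 - k) * (1 - Q ^+ (n.+1 - k)) * s k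
    + \sum_(k < n.+2) r k * (1 - Q ^+ k) * r (n.+1 - k) * Q ^+ (n.+1 - k) * s k.
  rewrite mulr_sumr -big_split /=; apply: eq_bigr => -[k kn] _ /=.
  have -> : Q ^+ n.+1 = Q ^+ (n.+1 - k) * Q ^+ k by rewrite -exprD subnK.
  ring.
rewrite mulrDr mulr1; congr (_ + _).
  rewrite big_ord_recr /= subnn expr0 subrr mulr0 mul0r addr0.
  apply: eq_bigr => -[k kn] _ /=; congr (_ * _).
  by rewrite subSn // -mulrA -rS.
rewrite [RHS]big_ord_recl /= expr0 subrr mulr0 !mul0r add0r mulr_suml.
apply: eq_bigr => -[k kn] _ /=; rewrite /bump /= add1n subSS -rS.
by rewrite -!mulrA sw // [s k.+1 * _]mulrC.
Qed.

Let x k := v ^+ k * Q ^+ 'C(k, 2).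
Let z k := u ^+ k * Q ^+ 'C(k, 2).
(* the bilateral sequence [..., z 2, z 1, x 0 = z 0, x 1, x 2, ...], with [x 0]
   at position [N] *)
Let s N k := if (N <= k)%N then x (k - N) else z (N - k).

Let xS k : x k.+1 = x k * v * Q ^+ k.
Proof. by rewrite /x binS bin1 exprS exprD; ring. Qed.
Let zS k : z k.+1 = z k * u * Q ^+ k.
Proof. by rewrite /z binS bin1 exprS exprD; ring. Qed.

(** The [q]-binomial theorem. Reflecting [k] to [N - k] replaces [s N] by [z], which does not depend
    on [N], so that induction on [N] can use [S_step]. *)
Let base N : \prod_(i < N) (1 + u * Q ^+ i) = p N * S N (s N).
Proof.
have -> : S N (s N) = S N z.
  rewrite /S (reindex_inj rev_ord_inj); apply: eq_bigr => -[k kN] _ /=.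
  rewrite subSS subKn // [r k * _]mulrC /s; congr (_ * _).
  case: leqP => [|_]; last by rewrite subKn.
  by case: k kN => [|k] kN; [rewrite subn0 subnn /x /z !expr0 | lia].
elim: N => [|N IHN].
  by rewrite /S /p big_ord_recl !big_ord0 /r /p big_ord0 /z !expr0 invr1; ring.
rewrite big_ord_recr /= IHN -mulrA S_step.
  by rewrite mulrA /p [\prod_(i < N.+1) _]big_ord_recr.
by move=> k kN; rewrite zS -!mulrA -exprD subnKC.
Qed.

Let finite_product M N :
  \prod_(i < M) (1 + v * Q ^+ i) * \prod_(i < N) (1 + u * Q ^+ i)
    = p (M + N) * S (M + N) (s N).
Proof.
elim: M => [|M IHM]; first by rewrite big_ord0 mul1r base.
rewrite big_ord_recr /= mulrAC IHM -mulrA S_step.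
  by rewrite mulrA /p [\prod_(i < (M + N).+1) _]big_ord_recr.
(* Three cases: both neighbours on the [v] side, the passage from [z 1] to [x 0] across the centre,
   and both on the [u] side. In the last two, [u * v = Q] absorbs a factor [u]. *)
move=> k kMN; rewrite /s; case: (leqP N k) => [Nk|kN].
  rewrite leqW // subSn // xS.
  have ME : M = (k - N + (M + N - k))%N by lia.
  by rewrite {1}ME exprD; ring.
case: leqP => [Nk1|k1N].
  have -> : (N - k = 1)%N by lia.
  have -> : (k.+1 - N = 0)%N by lia.
  have -> : (M + N - k = M.+1)%N by lia.
  by rewrite zS /z /x !expr0 exprS /Q; ring.
have [j jE] : exists j, (N - k = j.+1)%N by exists (N - k).-1; lia.
have -> : (N - k.+1 = j)%N by lia.
rewrite jE.
have -> : (M + N - k = M + j.+1)%N by lia.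
by rewrite zS exprD exprS; rewrite /Q; ring.
Qed.

Let x_small D k : (D <= k)%N -> eqm D (x k) 0.
Proof.
by move=> Dk; rewrite -(mul0r (Q ^+ 'C(k, 2))); apply: eqmM => //; apply: eqm_expr0.
Qed.
Let z_small D k : (D <= k)%N -> eqm D (z k) 0.
Proof.
by move=> Dk; rewrite -(mul0r (Q ^+ 'C(k, 2))); apply: eqmM => //; apply: eqm_expr0.
Qed.

Let p_stable D n : (D <= n)%N -> eqm D (p n) (p D).
Proof.
move=> Dn; rewrite -(subnKC Dn) /p big_split_ord /= -[X in eqm _ _ X]mulr1.
apply: eqmM => //; apply: eqm_prod1 => i _; rewrite -[X in eqm _ _ X]subr0.
have /eqmN := @eqm_expr0 _ D Q (D + i).+1 Q0 (leqW (leq_addr _ _)).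
exact: eqmD.
Qed.
Let r_stable D n : (D <= n)%N -> eqm D (r n) (r D).
Proof. by move=> Dn; apply: eqmV => //; apply: p_stable. Qed.

(* Modulo [q^D] the normalized Gaussian binomials in the middle are all [1], and
   the terms carrying the others vanish. *)
Let finite_product_limit D N : (D.*2 <= N)%N ->
  eqm D (p N * (\prod_(i < N) (1 + v * Q ^+ i) * \prod_(i < N) (1 + u * Q ^+ i)))
        (\sum_(i < N) (x i + z i.+1)).
Proof.
move=> DN; rewrite finite_product /S mulrA mulr_sumr.
apply: (@eqm_trans _ _ (\sum_(k < (N + N).+1) s N k)).
  have term_small c k : eqm D (s N k) 0 ->
      eqm D (c * (r k * r (N + N - k) * s N k)) (s N k).
    move=> sk; apply: (eqm_trans _ (eqm_sym sk)).
    rewrite -[X in eqm _ _ X](mulr0 (c * (r k * r (N + N - k)))) mulrA.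
    exact: eqmM.
  apply: eqm_sum => -[k kN] _ /=.
  have [kD|Dk] := ltnP k D.
    have sk : eqm D (s N k) 0.
      by rewrite /s ifF; [apply: z_small; lia | apply/negbTE; lia].
    exact: term_small.
  have [kD|Dk'] := ltnP (N + N - k) D.
    have sk : eqm D (s N k) 0.
      by rewrite /s ifT; [apply: x_small; lia | lia].
    exact: term_small.
  (* Now [k], [N + N - k], [N] and [N + N] are all at least [D], so every [p] and [r] may be
     replaced by its value at [D], and these cancel. *)
  rewrite mulrA -[X in eqm _ _ X]mul1r; apply: eqmM => //.
  have -> : 1 = p D * p D * (r D * r D).
    by rewrite mulrACA /r mulrV ?p_unit // mul1r.
  by apply: eqmM; apply: eqmM; (apply: p_stable || apply: r_stable); lia.
(* The last term is [x N], which vanishes modulo [q^D]; the other [N + N] terms are folded about the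
   centre. *)
rewrite big_ord_recr /= -[X in eqm _ _ X]addr0; apply: eqmD; last first.
  by rewrite /s ifT; [apply: x_small; lia | lia].
rewrite sum_centered => n nD; congr fpscoef; apply: eq_bigr => -[i iN] _ /=.
rewrite /s leq_addr addKn ifF; last by apply/negbTE; lia.
by rewrite subKn.
Qed.

(** The series is Ramanujan's theta function [f(v, u)]. The limit [a] is left free, so that each
    application can supply its own eta quotient. *)
Lemma triple_product a :
    conv (fun N => \prod_(i < N) (1 - Q ^+ i.+1)
      * (\prod_(i < N) (1 + v * Q ^+ i) * \prod_(i < N) (1 + u * Q ^+ i))) a ->
  conv (fun N => \sum_(i < N)
     (v ^+ i * Q ^+ 'C(i, 2) + u ^+ i.+1 * Q ^+ 'C(i.+1, 2))) a.
Proof.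
move=> Pa D; have [M Ma] := Pa D; exists (maxn M D.*2) => N.
rewrite geq_max => /andP[/Ma PN /finite_product_limit SN].
exact: eqm_trans (eqm_sym SN) PN.
Qed.

End TripleProduct.

Local Notation q := (fpsX int).

(** Taking [v = e q^(a+b)] and [u = e q^(a-b)] gives [Q = q^(2a)] and the bilateral series of
    [e^m q^(a m^2 + b m)], with [m = i] and [m = -(i + 1)] paired. The bound [b < a] makes the
    constant terms vanish and the natural-number subtractions exact. *)
Lemma triple_product_quadratic (e : fps int) (a b : nat) A :
    e * e = 1 -> (b < a)%N ->
  conv (fun N => \prod_(i < N) ((1 - q ^+ (2 * a * i.+1))
      * ((1 + e * q ^+ (2 * a * i + (a + b)))
         * (1 + e * q ^+ (2 * a * i + (a - b)))))) A ->
  conv (fun N => \sum_(i < N) (e ^+ i * q ^+ (a * i * i + b * i)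
      + e ^+ i.+1 * q ^+ (a * i.+1 * i.+1 - b * i.+1))) A.
Proof.
move=> ee ba PA.
have vE : e * q ^+ (a + b) * (e * q ^+ (a - b)) = q ^+ (2 * a).
  by rewrite mulrACA ee mul1r -exprD; congr (_ ^+ _); lia.
have coef_0 k : (0 < k)%N -> fpscoef (e * q ^+ k) 0 = 0.
  by move=> k0; rewrite mulrC fpscoefXnM k0.
(* This turns the exponent [(a + b) i + 2 a C(i, 2)] into [a i^2 + b i]. *)
have bin2E i : (2 * 'C(i, 2) + i = i * i)%N.
  by elim: i => // i; rewrite binS bin1; lia.
have := @triple_product _ (e * q ^+ (a - b)) (e * q ^+ (a + b)).
move/(_ (coef_0 _ _) (coef_0 _ _) A); rewrite [_ * (e * _)]mulrC vE => T.
apply: eq_conv (T _ _ _); [|lia|lia|]; last first.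
  apply: eq_conv PA => N; rewrite -!big_split /=; apply: eq_bigr => i _.
  have qE k : e * q ^+ k * (q ^+ (2 * a)) ^+ i = e * q ^+ (2 * a * i + k).
    by rewrite -mulrA -exprM -exprD addnC.
  by rewrite !qE -exprM.
move=> N; apply: eq_bigr => i _; rewrite !exprMn -!mulrA -!exprM -!exprD.
by congr (_ * _ ^+ _ + _ * _ ^+ _); have := bin2E i; have := bin2E i.+1; nia.
Qed.

Lemma big_group (T : Type) (idx : T) (op : Monoid.law idx) k N (F : nat -> T) :
  \big[op/idx]_(i < k * N) F i
    = \big[op/idx]_(i < N) \big[op/idx]_(j < k) F (k * i + j)%N.
Proof.
elim: N => [|N IHN]; first by rewrite muln0 !big_ord0.
by rewrite mulnSr big_split_ord IHN big_ord_recr.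
Qed.

(** Grouping factors in blocks of [j] lets eta products of different moduli be compared block by
    block. *)
Lemma eta_conv_scale k j : (0 < k)%N -> (0 < j)%N ->
  conv (fun N => \prod_(i < N) \prod_(m < j) (1 - q ^+ (k * (j * i + m).+1)))
       (eta k).
Proof.
move=> k0 j0; apply: eq_conv (conv_scale j0 (eta_conv k0)) => N.
by rewrite (big_group _ j N (fun n => 1 - q ^+ (k * n.+1))).
Qed.

(** * Theta functions *)

Lemma phi_conv :
  conv (fun N => \sum_(i < N) (q ^+ (i * i) + q ^+ (i.+1 * i.+1))) phi.
Proof.
move=> D; exists D => N DN n nD.
pose G (k : nat) := (((k%:Z - n%:Z) ^+ 2 == n%:Z) : nat)%:R : int.
have -> : fpscoef phi n = \sum_(k < n.*2.+1) G k.
  rewrite /= cardsE -sum1_card -natz natr_sum big_mkcond /=.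
  by apply: eq_bigr => i _; rewrite /G unfold_in -mulrb.
rewrite -addnn big_ord_recr /= sum_centered fpscoef_sum.
have nN : (n < N)%N by apply: leq_trans DN.
rewrite -(subnKC nN) big_split_ord [X in _ + X = _]big1 ?addr0; last first.
  move=> i _; rewrite fpscoefD !fpscoefXn /=.
  have /negbTE-> : (n != (n.+1 + i) * (n.+1 + i))%N by nia.
  have /negbTE-> : (n != (n.+1 + i).+1 * (n.+1 + i).+1)%N by nia.
  by [].
(* The unpaired term on the left is [m = n]; on the right, index [n] also carries the exponent
   [(n + 1)^2], which exceeds [n]. *)
rewrite big_ord_recr; congr (_ + _).
  apply: eq_bigr => -[i iN] _; rewrite fpscoefD !fpscoefXn /G.
  have -> : (n + i)%N%:Z - n%:Z = i%:Z by lia.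
  have -> : (n - i.+1)%N%:Z - n%:Z = - i.+1%:Z by lia.
  by rewrite sqrrN !expr2 -!PoszM !eqz_nat ![n == _]eq_sym.
rewrite fpscoefD !fpscoefXn /G.
have /negbTE-> : (n != n.+1 * n.+1)%N by nia.
have -> : (n + n)%N%:Z - n%:Z = n%:Z by lia.
by rewrite addr0 expr2 -PoszM eqz_nat eq_sym.
Qed.

Lemma psi_conv : conv (fun N => \sum_(i < N) q ^+ (i * i.+1)./2) psi.
Proof.
move=> D; exists D => N DN n nD.
have -> : fpscoef psi n = \sum_(k < n.+1) (((k * k.+1)./2 == n) : nat)%:R.
  rewrite /= cardsE -sum1_card -natz natr_sum big_mkcond /=.
  by apply: eq_bigr => i _; rewrite unfold_in -mulrb.
rewrite fpscoef_sum.
have nN : (n < N)%N by apply: leq_trans DN.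
rewrite -(subnKC nN) big_split_ord [X in _ + X = _]big1 ?addr0; last first.
  move=> i _; rewrite fpscoefXn /=.
  suff /negbTE-> : (n != ((n.+1 + i) * (n.+1 + i).+1)./2)%N by [].
  have : (n.+1 <= ((n.+1 + i) * (n.+1 + i).+1)./2)%N by rewrite geq_half_double; nia.
  lia.
by apply: eq_bigr => i _; rewrite fpscoefXn eq_sym.
Qed.

Lemma expr_mul (S : comNzRingType) (x : S) k n : x ^+ (k * n) = (x ^+ n) ^+ k.
Proof. by rewrite mulnC exprM. Qed.

(** * Finite forms of the product formulas *)

Section FiniteProducts.
Variables (S : comNzRingType) (x : S) (N : nat).

Definition poch k := \prod_(i < N) (1 - x ^+ (k * i.+1)).
(* the first [j * N] factors of the product whose first [N] factors form
   [poch k] *)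
Definition poch_group k j :=
  \prod_(i < N) \prod_(m < j) (1 - x ^+ (k * (j * i + m).+1)).
Definition triple (e : S) a b :=
  \prod_(i < N) ((1 - x ^+ (2 * a * i.+1))
    * ((1 + e * x ^+ (2 * a * i + (a + b))) * (1 + e * x ^+ (2 * a * i + (a - b))))).

Local Ltac termwise :=
  rewrite /triple /poch_group /poch -?prodrXl -?big_split; apply: eq_bigr => i _;
  rewrite !big_ord_recr !big_ord0 /=;
  rewrite ?[(2 - 1)%N]/= ?[(3 - 2)%N]/=;
  rewrite !(expr_mul, exprS, exprD, expr0, addn0, subn0, subSS); ring.

(** As in [triple_psi], plus signs are removed by [1 + y = (1 - y^2) / (1 - y)], cross-multiplied.
    Block sizes are chosen so that the factors of index [i] already agree, as polynomials in [x] and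
    [x^i]. *)
Lemma triple_phi : triple 1 1 0 * (poch_group 1 2 ^+ 2 * poch 4 ^+ 2)
  = poch 2 ^+ 3 * poch_group 2 2 ^+ 2.
Proof. termwise. Qed.

Lemma triple_phiN : triple (-1) 1 0 * poch 2 = poch_group 1 2 ^+ 2.
Proof. termwise. Qed.

Lemma triple_psi : triple 1 2 1 * (poch_group 1 4 * poch_group 4 2)
  = poch 4 * poch_group 2 4 * poch_group 2 2.
Proof. termwise. Qed.

Lemma triple_omega : triple (-1) 3 2 * (poch_group 2 3 * poch_group 3 2)
  = poch_group 1 6 * poch 6 ^+ 2.
Proof. termwise. Qed.

End FiniteProducts.

Local Notation phiN := (fps_subst (-1) 1 phi).

Lemma poch_conv k : (0 < k)%N -> conv (fun N => poch q N k) (eta k).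
Proof. exact: eta_conv. Qed.

Lemma poch_group_conv k j : (0 < k)%N -> (0 < j)%N ->
  conv (fun N => poch_group q N k j) (eta k).
Proof. exact: eta_conv_scale. Qed.

Lemma fps_subst1Xn k n : (0 < k)%N -> fps_subst 1 k (q ^+ n) = q ^+ (k * n).
Proof. by case: k => // k _; rewrite rmorphXn /= fps_subst1X // -exprM. Qed.

Lemma phiN_conv : conv (fun N => \sum_(i < N)
  ((-1) ^+ i * q ^+ (i * i) + (-1) ^+ i.+1 * q ^+ (i.+1 * i.+1))) phiN.
Proof.
apply: eq_conv (conv_subst _ _ phi_conv) => // N.
have qE n : fps_subst (-1) 1 (q ^+ (n * n)) = (-1) ^+ n * q ^+ (n * n).
  rewrite rmorphXn /= fps_substN1X // expr1 (exprNn (fpsX int)).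
  by rewrite -(signr_odd _ (n * n)) oddM andbb signr_odd.
by rewrite rmorph_sum; apply: eq_bigr => i _; rewrite rmorphD /= !qE.
Qed.

Lemma phi_eta : phi = eta 2 ^+ 5 / (eta 1 ^+ 2 * eta 4 ^+ 2).
Proof.
apply: conv_uniq phi_conv _.
apply: eq_conv (@triple_product_quadratic 1 1 0 _ (mulr1 1) isT _) => [N|].
  by apply: eq_bigr => i _; rewrite !expr1n !mul1r !mul1n !mul0n addn0 subn0.
apply: conv_div (fun N => triple_phi q N) _ _.
- by rewrite unitrM !unitrX ?eta_unit.
- by apply: convM; apply: convX; [apply: poch_group_conv | apply: poch_conv].
rewrite [X in conv _ X](_ : _ = eta 2 ^+ 3 * eta 2 ^+ 2); last by rewrite -exprD.
by apply: convM; apply: convX; [apply: poch_conv | apply: poch_group_conv].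
Qed.

Fact mulrN1N1 : -1 * -1 = 1 :> fps int.
Proof. by rewrite mulrNN mulr1. Qed.

Lemma phiN_eta : phiN = eta 1 ^+ 2 / eta 2.
Proof.
apply: conv_uniq phiN_conv _.
apply: eq_conv (@triple_product_quadratic (-1) 1 0 _ mulrN1N1 isT _) => [N|].
  by apply: eq_bigr => i _; rewrite !mul1n !mul0n addn0 subn0.
apply: conv_div (fun N => triple_phiN q N) _ _; first exact: eta_unit.
  exact: poch_conv.
by apply: convX; apply: poch_group_conv.
Qed.

Lemma double_triangular i : (2 * (i * i.+1)./2 = i * i.+1)%N.
Proof. by rewrite mul2n halfK oddM /= andbN subn0. Qed.

(** The triangular numbers of index [2i] and [2i + 1] are [2 m^2 + m] at [m = i] and [m = -(i + 1)],
    so [psi] is a bilateral quadratic series. *)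
Lemma psi_eta : psi = eta 2 ^+ 2 / eta 1.
Proof.
(* The extra [eta 4] matches the factors of modulus 4 on both sides of [triple_psi]. *)
have -> : eta 2 ^+ 2 / eta 1 = eta 4 * eta 2 ^+ 2 / (eta 1 * eta 4).
  by rewrite invrM ?eta_unit // [eta 4 * _]mulrC mulrA mulrK ?eta_unit.
apply: conv_uniq (conv_scale (k := 2) isT psi_conv) _.
apply: eq_conv (@triple_product_quadratic 1 2 1 _ (mulr1 1) isT _) => [N|].
  rewrite (big_group _ 2 N (fun i => q ^+ (i * i.+1)./2)); apply: eq_bigr => i _.
  rewrite !big_ord_recr big_ord0 /= add0r !expr1n !mul1r.
  congr (_ ^+ _ + _ ^+ _).
    by have := double_triangular (2 * i + 0); nia.
  by have := double_triangular (2 * i + 1); nia.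
apply: conv_div (fun N => triple_psi q N) _ _.
- by rewrite unitrM ?eta_unit.
- by apply: convM; apply: poch_group_conv.
rewrite expr2 mulrA.
by do 2?apply: convM; [apply: poch_conv | apply: poch_group_conv..].
Qed.

(* The companion of [phi(-q^3)] in the 3-dissection of [phi(-q)]; its series is
   [\sum_(m in Z) (-1)^m q^(3 m^2 + 2 m)]. *)
Definition omega : fps int := eta 1 * eta 6 ^+ 2 / (eta 2 * eta 3).

Lemma omega_conv : conv (fun N => \sum_(i < N)
  ((-1) ^+ i * q ^+ (3 * i * i + 2 * i)
   + (-1) ^+ i.+1 * q ^+ (3 * i.+1 * i.+1 - 2 * i.+1))) omega.
Proof.
apply: (triple_product_quadratic mulrN1N1) => //.
apply: conv_div (fun N => triple_omega q N) _ _.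
- by rewrite unitrM ?eta_unit.
- by apply: convM; apply: poch_group_conv.
by apply: convM; [apply: poch_group_conv | apply: convX; apply: poch_conv].
Qed.

(** Split by the parity of [m]: even [m] gives [phi(q^4)]; the square of an odd [m] is [8 t + 1]
    with [t] triangular, reached once from each sign of [m]. *)
Lemma phi_dissection : phi = fps_subst 1 4 phi + 2 * q * fps_subst 1 8 psi.
Proof.
apply: conv_uniq (conv_scale (k := 2) isT phi_conv) _.
apply: eq_conv (convD (conv_subst 1 (k := 4) _ phi_conv)
  (convM (conv_cst (2 * q)) (conv_subst 1 (k := 8) _ psi_conv))) => // N.
rewrite (big_group _ 2 N (fun i => q ^+ (i * i) + q ^+ (i.+1 * i.+1))).
rewrite !rmorph_sum mulr_sumr -big_split; apply: eq_bigr => i _.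
rewrite !big_ord_recr big_ord0 /= add0r rmorphD /= !fps_subst1Xn // -mulrA -exprS.
have tE := double_triangular i.
have -> : ((2 * i + 0) * (2 * i + 0) = 4 * (i * i))%N by nia.
have -> : ((2 * i + 0).+1 * (2 * i + 0).+1 = (8 * (i * i.+1)./2).+1)%N by nia.
have -> : ((2 * i + 1) * (2 * i + 1) = (8 * (i * i.+1)./2).+1)%N by nia.
have -> : ((2 * i + 1).+1 * (2 * i + 1).+1 = 4 * (i.+1 * i.+1))%N by nia.
ring.
Qed.

(** Split by [m] modulo 3. Multiples of 3 give [phi(-q^9)]; [m = 3j + 1] contributes
    [-(-1)^j q^(1 + 3 (3 j^2 + 2 j))], summing to [-q omega(q^3)], and the class of [-1] is its
    reflection. *)
Lemma phiN_dissection :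
  phiN = fps_subst 1 9 phiN - 2 * q * fps_subst 1 3 omega.
Proof.
apply: conv_uniq (conv_scale (k := 3) isT phiN_conv) _.
rewrite -mulNr.
apply: eq_conv (convD (conv_subst 1 (k := 9) _ phiN_conv)
  (convM (conv_cst (- (2 * q))) (conv_subst 1 (k := 3) _ omega_conv))) => // N.
rewrite (big_group _ 3 N (fun i =>
  (-1) ^+ i * q ^+ (i * i) + (-1) ^+ i.+1 * q ^+ (i.+1 * i.+1))).
rewrite !rmorph_sum mulr_sumr -big_split; apply: eq_bigr => i _.
rewrite !big_ord_recr big_ord0 /= add0r !rmorphD !rmorphM /=.
rewrite !rmorphXn !rmorphN1 -![fps_subst _ _ q ^+ _]rmorphXn /= !fps_subst1Xn //.
have -> : ((3 * i + 0) * (3 * i + 0) = 9 * (i * i))%N by nia.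
have -> : q ^+ ((3 * i + 0).+1 * (3 * i + 0).+1) = q * q ^+ (3 * (3 * i * i + 2 * i)).
  by rewrite -exprS; congr (_ ^+ _); nia.
have -> : q ^+ ((3 * i + 1) * (3 * i + 1)) = q * q ^+ (3 * (3 * i * i + 2 * i)).
  by rewrite -exprS; congr (_ ^+ _); nia.
have -> : q ^+ ((3 * i + 1).+1 * (3 * i + 1).+1)
    = q * q ^+ (3 * (3 * i.+1 * i.+1 - 2 * i.+1)).
  by rewrite -exprS; congr (_ ^+ _); nia.
have -> : q ^+ ((3 * i + 2) * (3 * i + 2)) = q * q ^+ (3 * (3 * i.+1 * i.+1 - 2 * i.+1)).
  by rewrite -exprS; congr (_ ^+ _); nia.
have -> : ((3 * i + 2).+1 * (3 * i + 2).+1 = 9 * (i.+1 * i.+1))%N by nia.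
have sE m : (-1) ^+ (3 * i + m) = (-1) ^+ i * (-1) ^+ m :> fps int.
  rewrite exprD exprM; congr (_ ^+ _ * _); ring.
rewrite -!addnS !sE [_ ^+ i.+1]exprS.
ring.
Qed.

Lemma eta_subst k j : (0 < k)%N -> (0 < j)%N -> fps_subst 1 k (eta j) = eta (k * j).
Proof.
move=> k0 j0; have kj0 : (0 < k * j)%N by rewrite muln_gt0 k0.
apply: conv_uniq (eta_conv kj0).
apply: eq_conv (conv_subst 1 k0 (eta_conv j0)) => N.
case: k k0 {kj0} => // k _; rewrite rmorph_prod; apply: eq_bigr => i _.
by rewrite rmorphB rmorph1 rmorphXn /= fps_subst1X // -exprM mulnA.
Qed.

(** * The norm of [phi(-q)] under [q -> z q], [z^3 = 1] *)

Section Map.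
Variables (R S : comNzRingType) (f : {rmorphism R -> S}).

(** Extension of scalars, used to pass from integer coefficients to algebraic numbers, where a
    primitive cube root of unity exists. *)
Definition fps_map (F : fps R) : fps S := \fps_n f (fpscoef F n).

Fact fps_map_is_zmod_morphism : zmod_morphism fps_map.
Proof. by move=> F G; apply/fpsP => n; rewrite /= rmorphB. Qed.
Fact fps_map_is_monoid_morphism : monoid_morphism fps_map.
Proof.
split=> [|F G]; apply/fpsP => n /=; first by rewrite rmorph_nat.
by rewrite rmorph_sum; apply: eq_bigr => i _; rewrite rmorphM.
Qed.
HB.instance Definition _ := GRing.isZmodMorphism.Build (fps R) (fps S)
  fps_map fps_map_is_zmod_morphism.
HB.instance Definition _ := GRing.isMonoidMorphism.Build (fps R) (fps S)
  fps_map fps_map_is_monoid_morphism.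

Lemma fps_map_inj : injective f -> injective fps_map.
Proof.
by move=> f_inj F G /fpsP FG; apply/fpsP => n; apply: f_inj; apply: FG.
Qed.

Lemma fps_mapX : fps_map (fpsX R) = fpsX S.
Proof. by apply/fpsP => n /=; rewrite !coefX rmorph_nat. Qed.

Lemma fps_map_subst c k F : fps_map (fps_subst c k F) = fps_subst (f c) k (fps_map F).
Proof.
by apply/fpsP => n /=; case: ifP => _; rewrite ?rmorph0 // rmorphM rmorphXn.
Qed.

Lemma conv_map u a : conv u a -> conv (fun N => fps_map (u N)) (fps_map a).
Proof.
by move=> ua D; have [M Ma] := ua D; exists M => N /Ma ea n /ea /= ->.
Qed.

End Map.

(* [(1 - y) (1 - t y) (1 - t^2 y) = 1 - y^3], at [y = x^n] with [n] prime to 3. *)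
Lemma norm_product (S : comNzRingType) (x t : S) N : t ^+ 2 = - 1 - t ->
  poch_group x N 1 3 * poch_group (t * x) N 1 3 * poch_group (t ^+ 2 * x) N 1 3
    * poch x N 9
  = poch_group x N 3 3 * poch x N 3 ^+ 3.
Proof.
move=> t2; have t3 : t ^+ 3 = 1 by ring: t2.
rewrite /poch_group /poch -prodrXl -!big_split; apply: eq_bigr => i _.
rewrite !big_ord_recr !big_ord0 /=.
(* Only exponents modulo 3 matter for [t]. The factor of exponent [3i + 3] is common to the three
   products, hence the cube of [poch x N 3]; [poch x N 9] supplies the multiples of 9 missing from
   [poch_group x N 3 3]. *)
have tE m : t ^+ (1 * (3 * i + m).+1) = t ^+ m.+1.
  by rewrite mul1n -addnS exprD exprM t3 expr1n mul1r.
rewrite !exprMn !tE.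
rewrite !(expr_mul, exprS, exprD, expr0, addn0).
ring: t2.
Qed.

Section Norm.
Let toC := fps_map (intmul (1 : algC)).
Variable z : algC.
Hypothesis z_prim : 3.-primitive_root z.

Let z2 : z ^+ 2 = -1 - z.
Proof.
have z3 := prim_expr_order z_prim.
have z1 : z != 1.
  by apply/eqP => z1; have := prim_order_dvd z_prim 1; rewrite z1 expr1 eqxx.
apply/eqP; rewrite -subr_eq0 -(mulrI_eq0 _ (mulfI (_ : z - 1 != 0))) ?subr_eq0 //.
by apply/eqP; rewrite -[RHS](subrr (z ^+ 3)) {2}z3; ring.
Qed.

Let t : fps algC := fps_of_poly z%:P.
Let t2 : t ^+ 2 = -1 - t.
Proof. by rewrite /t -!rmorphXn /= z2 !rmorphB !rmorphN1. Qed.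

Let E k := toC (eta k).
Let sub c F := fps_subst (c : algC) 1 F.

Let E1_conv c :
  conv (fun N => poch_group (fps_of_poly c%:P * fpsX algC) N 1 3) (sub c (E 1)).
Proof.
have E1 := @poch_group_conv 1 3 isT isT.
apply: eq_conv (conv_subst c (k := 1) isT (conv_map _ E1)) => N.
rewrite /poch_group !rmorph_prod; apply: eq_bigr => i _.
rewrite !rmorph_prod; apply: eq_bigr => j _.
by rewrite !(rmorphB, rmorph1, rmorphXn) /= fps_mapX fps_substX.
Qed.

Let E_conv k : (0 < k)%N -> conv (fun N => poch (fpsX algC) N k) (E k).
Proof.
move=> k0; apply: eq_conv (conv_map _ (poch_conv k0)) => N.
rewrite /poch !rmorph_prod; apply: eq_bigr => i _.
by rewrite !(rmorphB, rmorph1, rmorphXn) /= fps_mapX.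
Qed.

Let E_group_conv k : (0 < k)%N -> conv (fun N => poch_group (fpsX algC) N k 3) (E k).
Proof.
move=> k0; apply: eq_conv (conv_map _ (poch_group_conv k0 (j := 3) isT)) => N.
rewrite /poch_group !rmorph_prod; apply: eq_bigr => i _.
rewrite !rmorph_prod; apply: eq_bigr => j _.
by rewrite !(rmorphB, rmorph1, rmorphXn) /= fps_mapX.
Qed.

Let eta1_norm : E 1 * sub z (E 1) * sub (z ^+ 2) (E 1) * E 9 = E 3 ^+ 4.
Proof.
have c1 := convM (E_group_conv (k := 3) isT) (convX 3 (E_conv (k := 3) isT)).
rewrite exprS; apply: conv_uniq c1.
apply: eq_conv (convM (convM (convM (E_group_conv (k := 1) isT) (E1_conv z))
  (E1_conv (z ^+ 2))) (E_conv (k := 9) isT)) => N.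
by rewrite polyC_exp rmorphXn /= (norm_product _ _ t2).
Qed.

Let z3 : z ^+ 3 = 1 := prim_expr_order z_prim.

Let eta_scale k j : (0 < k)%N -> (0 < j)%N -> fps_subst 1 k (E j) = E (k * j).
Proof.
by move=> k0 j0; rewrite /E /toC -(eta_subst k0 j0) fps_map_subst /= rmorph1.
Qed.

(** Substitute [q^2] for [q] in [eta1_norm]: since [f_2] at [z q] is [f_1] at [z^2 q^2], the
    conjugates by [z] and [z^2] are exchanged. *)
Let eta2_norm : E 2 * sub z (E 2) * sub (z ^+ 2) (E 2) * E 18 = E 6 ^+ 4.
Proof.
have /(congr1 (fps_subst 1 2)) := eta1_norm; rewrite rmorphXn !rmorphM /=.
rewrite /sub !fps_subst_comp // !eta_scale // !expr1n !mulr1.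
rewrite -[E (2 * 1)](eta_scale) // !fps_subst_comp // !mul1r.
rewrite -exprM (_ : z ^+ (2 * 2) = z); last first.
  by rewrite -[LHS]/(z ^+ (3 + 1)) exprD z3 mul1r.
by rewrite mulrAC -!mulrA [_ * (_ * E 18)]mulrCA !mulrA => <-; ring.
Qed.

Lemma phiN_norm_of_root :
  (fps_subst 1 9 phiN ^+ 3 - 8 * fpsX int ^+ 3 * fps_subst 1 3 omega ^+ 3)
    * (eta 6 ^+ 4 * eta 9 ^+ 2) = eta 3 ^+ 8 * eta 18.
Proof.
apply: (fps_map_inj (f := intmul (1 : algC)) intr_inj).
have [w wE] : exists w, w = omega by exists omega.
have [p pE] : exists p, p = phiN by exists phiN.
rewrite -wE -pE !(rmorphXn, rmorphB, rmorphM) /= !rmorph_nat fps_mapX -/toC.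
rewrite -/(E 6) -/(E 9) -/(E 3) -/(E 18).
pose P := toC p; pose A := toC (fps_subst 1 9 p); pose W := toC (fps_subst 1 3 w).
pose q := fpsX algC; rewrite -/A -/W -/q.
have PE : P * E 2 = E 1 ^+ 2.
  by rewrite /P pE phiN_eta /E /toC -rmorphM -rmorphXn /= divrK ?eta_unit.
(* [A] and [W] are series in [q^9] and [q^3], hence fixed by [q -> c q] when [c^3 = 1]. *)
have sA c : c ^+ 3 = 1 -> sub c A = A.
  move=> c3; rewrite /A /toC fps_map_subst /= rmorph1 /sub fps_subst_comp // mul1r.
  by rewrite (exprM _ 3 3) c3 expr1n.
have sW c : c ^+ 3 = 1 -> sub c W = W.
  by move=> c3; rewrite /W /toC fps_map_subst /= rmorph1 /sub fps_subst_comp // mul1r c3.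
have PD : P = A - 2 * q * W.
  rewrite /P {1}pE phiN_dissection -pE -wE /toC rmorphB !rmorphM /=.
  by rewrite rmorph_nat fps_mapX.
have sP c : c ^+ 3 = 1 -> sub c P = A - 2 * (fps_of_poly c%:P * q) * W.
  move=> c3; rewrite PD /sub rmorphB !rmorphM /= rmorph_nat fps_substX // expr1.
  by rewrite -![fps_subst c 1 _]/(sub c _) sA // sW.
have zz3 : (z ^+ 2) ^+ 3 = 1 by rewrite -exprM mulnC exprM z3 expr1n.
have sPE c : sub c P * sub c (E 2) = sub c (E 1) ^+ 2.
  by rewrite /sub -rmorphM -rmorphXn PE.
have normP : A ^+ 3 - 8 * q ^+ 3 * W ^+ 3 = P * sub z P * sub (z ^+ 2) P.
  rewrite !sP // PD polyC_exp rmorphXn /= -/t.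
  by ring: t2.
(* Both norms are substituted: [eta1_norm] squared for the numerators [f_1^2] of the conjugates of
   [P], and [eta2_norm] for their denominators [f_2]. *)
have -> : E 3 ^+ 8 = (E 3 ^+ 4) ^+ 2 by ring.
rewrite normP -eta1_norm -eta2_norm.
rewrite !exprMn -PE -!sPE; ring.
Qed.

End Norm.

Lemma phiN_norm :
  (fps_subst 1 9 phiN ^+ 3 - 8 * fpsX int ^+ 3 * fps_subst 1 3 omega ^+ 3)
    * (eta 6 ^+ 4 * eta 9 ^+ 2) = eta 3 ^+ 8 * eta 18.
Proof.
by have [z z_prim] := C_prim_root_exists (isT : 0 < 3)%N; apply: phiN_norm_of_root z_prim.
Qed.

(** * The generating function of overpartitions *)

(** Factors of index at least [N] are [1] modulo [q^(N+1)]. The multiplier [k] allows the limit to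
    be known only along whole blocks. *)
Lemma eqm_prod_conv (R : comNzRingType) (F : nat -> fps R) a k N : (0 < k)%N ->
    (forall i, eqm i.+1 (F i) 1) -> conv (fun M => \prod_(i < k * M) F i) a ->
  eqm N.+1 (\prod_(i < N) F i) a.
Proof.
move=> k0 F1 /(_ N.+1) [M Ma].
apply: eqm_trans (Ma (maxn M N) (leq_maxl _ _)).
have NM : (N <= k * maxn M N)%N by rewrite (leq_trans (leq_maxr M N)) ?leq_pmull.
rewrite -(subnKC NM) big_split_ord /= -[X in eqm _ X _]mulr1.
apply: eqmM => //; apply: eqm_sym; apply: eqm_prod1 => i _.
by apply: eqmW (F1 _); rewrite ltnS leq_addr.
Qed.

Section Generating.
Variables (l n : nat).
Hypothesis l0 : (0 < l)%N.

(* [j] is the multiplicity of the part [x], and whether it is overlined. *)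
Definition allowed (x : bool * 'I_n) (j : 'I_n.+1 * bool) : bool :=
  (j.2 ==> (0 < j.1)%N) && (x.1 ==> (0 < j.1)%N ==> (l %| x.2.+1)%N).

Definition part_series (x : bool * 'I_n) : fps int :=
  \sum_(j : 'I_n.+1 * bool | allowed x j) q ^+ (j.1 * x.2.+1).

(** An overpartition is an independent choice of multiplicity and overlining for each coloured part;
    [h] packs these choices into one function, so that the product of sums expands over
    overpartitions. *)
Lemma pbar_coef : (pbar l n)%:Z = fpscoef (\prod_x part_series x) n.
Proof.
pose h (p : {ffun bool * 'I_n -> 'I_n.+1} * {set bool * 'I_n}) :=
  [ffun x => (p.1 x, x \in p.2)].
pose h' (f : {ffun bool * 'I_n -> 'I_n.+1 * bool}) :=
  ([ffun x => (f x).1], [set x | (f x).2]).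
have hK : cancel h h'.
  move=> [m o]; congr (_, _); first by apply/ffunP => x; rewrite !ffunE.
  by apply/setP => x; rewrite inE ffunE.
have h'K : cancel h' h.
  by move=> f; apply/ffunP => x; rewrite !ffunE inE; case: (f x).
rewrite /part_series; under eq_bigr => x _ do rewrite big_mkcond.
rewrite bigA_distr_bigA (reindex h); last by exists h' => ? _.
rewrite fpscoef_sum /pbar cardsE -sum1_card -natz natr_sum big_mkcond.
apply: eq_bigr => -[m o] _; rewrite -[_ \in _]/(is_overpartition l (m, o)).
have -> : \prod_x (if allowed x (h (m, o) x) then q ^+ ((h (m, o) x).1 * x.2.+1) else 0)
  = if [forall x, allowed x (h (m, o) x)] then q ^+ (\sum_x m x * x.2.+1) else 0.
  case: ifP => [/forallP ok|/negbT].
    by rewrite expr_sum; apply: eq_bigr => x _; rewrite ok ffunE.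
  by rewrite negb_forall => /existsP[x /negbTE xF]; rewrite (bigD1 x) //= xF mul0r.
have -> : is_overpartition l (m, o)
    = (\sum_x m x * x.2.+1 == n)%N && [forall x, allowed x (h (m, o) x)].
  rewrite /is_overpartition; congr (_ && _); symmetry.
  apply/forallP/andP => [ok|[/forallP ok1 /forallP ok2] [c i]].
    split; apply/forallP => x; first by have := ok x; rewrite ffunE => /andP[].
    by have := ok (true, x); rewrite ffunE => /andP[].
  rewrite ffunE; apply/andP; split; first exact: ok1.
  by case: c => //=; apply: ok2.
case: [forall x, _]; last by rewrite andbF.
by rewrite andbT fpscoefXn eq_sym mulrb.
Qed.

(** With [y = q^s], an admissible part of size [s] contributes [1 + 2y + 2y^2 + ... = (1 - y^2) / (1
    - y)^2], as each positive multiplicity may be overlined or not; a forbidden part contributes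
    [1]. *)
Lemma part_seriesE x : eqm n.+1
  (part_series x * (if x.1 ==> (l %| x.2.+1)%N then 1 - q ^+ x.2.+1 else 1) ^+ 2)
  (if x.1 ==> (l %| x.2.+1)%N then 1 - q ^+ (2 * x.2.+1) else 1).
Proof.
rewrite /part_series.
have -> : \sum_(j : 'I_n.+1 * bool | allowed x j) q ^+ (j.1 * x.2.+1)
  = 1 + \sum_(m < n) (if x.1 ==> (l %| x.2.+1)%N then 2 * q ^+ (m.+1 * x.2.+1) else 0).
  rewrite big_mkcond /= -(pair_big xpredT xpredT (fun (m : 'I_n.+1) (o : bool) =>
    if allowed x (m, o) then q ^+ (m * x.2.+1) else 0)) /=.
  rewrite big_ord_recl big_bool /allowed /= implybT mul0n expr0 add0r; congr (_ + _).
  apply: eq_bigr => m _; rewrite big_bool /=; case: ifP => _ //; rewrite ?addr0 //.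
  by rewrite mulr_natl.
case: ifP => _; last by rewrite big1_eq addr0 expr1n mulr1.
set y := q ^+ x.2.+1.
have -> : \sum_(m < n) 2 * q ^+ (m.+1 * x.2.+1) = 2 * y * \sum_(m < n) y ^+ m.
  by rewrite mulr_sumr; apply: eq_bigr => m _; rewrite -mulrA -exprS -exprM mulnC.
(* Bounding multiplicities by [n] costs an error divisible by [y^(n+1)], hence zero modulo
   [q^(n+1)]. *)
have -> : (1 + 2 * y * \sum_(m < n) y ^+ m) * (1 - y) ^+ 2
    = (1 - y ^+ 2) - 2 * y ^+ n.+1 * (1 - y).
  have := subrX1 y n; set s := \sum_(m < n) _ => sE.
  by rewrite (exprS y n) -[y ^+ n](subrK 1) sE; ring.
rewrite expr_mul -/y -[X in eqm _ _ X]subr0; apply: eqmD => //.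
rewrite -[X in eqm _ _ (- X)](mulr0 (2 * (1 - y))) mulrAC; apply: eqmN.
apply: eqmM => //; apply: eqm_expr0 => //.
by rewrite fpscoefXn.
Qed.

Lemma prod_parts k : (0 < k)%N -> eqm n.+1
  (\prod_(x : bool * 'I_n) (if x.1 ==> (l %| x.2.+1)%N then 1 - q ^+ (k * x.2.+1) else 1))
  (eta k * eta (k * l)).
Proof.
move=> k0.
rewrite -(pair_big xpredT xpredT (fun (c : bool) (i : 'I_n) =>
  if c ==> (l %| i.+1)%N then 1 - q ^+ (k * i.+1) else 1)) /= big_bool /= mulrC.
have F1 i : eqm i.+1 (1 - q ^+ (k * i.+1)) 1.
  move=> m mi; rewrite fpscoefD fpscoefN fpscoefXn ltn_eqF ?subr0 //.
  by rewrite (leq_trans mi) ?leq_pmull.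
apply: eqmM.
  apply: (@eqm_prod_conv _ (fun i => 1 - q ^+ (k * i.+1)) _ 1) => //.
  exact: conv_scale (eta_conv k0).
apply: (@eqm_prod_conv _
  (fun i => if (l %| i.+1)%N then 1 - q ^+ (k * i.+1) else 1) _ l) => //.
  by move=> i; case: ifP => // _; apply: F1.
have kl0 : (0 < k * l)%N by rewrite muln_gt0 k0.
apply: eq_conv (eta_conv kl0) => N.
rewrite (big_group _ l N (fun i => if (l %| i.+1)%N then 1 - q ^+ (k * i.+1) else 1)).
(* In each block of [l] consecutive part sizes only the last is a multiple of [l]. *)
apply: eq_bigr => i _; case: l l0 => // l' _; rewrite big_ord_recr /= big1.
  by rewrite -addnS -mulnSr dvdn_mulr // mul1r mulnA.
move=> j _; rewrite -addnS dvdn_addr ?dvdn_mulr // gtnNdvd //=.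
by rewrite ltnS.
Qed.

End Generating.

(** The finite product giving the coefficient of [q^n] itself depends on [n], so the comparison is
    made modulo [q^(n+1)] for each [n], using [prod_parts] at 2 for the numerator and at 1 for the
    denominator. *)
Lemma pbar_generating l : (0 < l)%N ->
  \fps_n (pbar l n)%:Z = eta 2 * eta (2 * l) / (eta 1 ^+ 2 * eta l ^+ 2).
Proof.
move=> l0; apply/fpsP => n /=; rewrite pbar_coef.
have U : eta 1 ^+ 2 * eta l ^+ 2 \is a GRing.unit by rewrite unitrM !unitrX ?eta_unit.
suff E : eqm n.+1 (\prod_x @part_series l n x)
  (eta 2 * eta (2 * l) / (eta 1 ^+ 2 * eta l ^+ 2)) by rewrite E.
rewrite -[X in eqm _ X _](mulrK U); apply: eqmM => //.
apply: eqm_trans (@prod_parts l n l0 2 isT).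
apply: eqm_trans; last exact: (eqm_prod _ (fun x _ => @part_seriesE l n x)).
rewrite big_split prodrXl; apply: eqmM => //.
rewrite -exprMn; apply: eqmX; apply: eqm_sym.
have := @prod_parts l n l0 1 isT; rewrite mul1n => parts1; apply: eqm_trans parts1.
by move=> m _; congr fpscoef; apply: eq_bigr => x _; rewrite mul1n.
Qed.

(** * Dissections *)

Lemma fpscoef_dissection (R : comNzRingType) k r s (B : fps R) n :
    (r < k)%N -> (s < k)%N ->
  fpscoef (fpsX R ^+ s * fps_subst 1 k B) (k * n + r)
    = if r == s then fpscoef B n else 0.
Proof.
move=> rk sk; have k0 : (0 < k)%N by apply: leq_trans rk.
rewrite fpscoefXnM; case: (eqVneq r s) => [->|rs].
  by rewrite ltnNge leq_addl addnK /= dvdn_mulr // mulKn // expr1n mul1r.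
case: ltnP => // le_s /=; case: ifP => // /dvdnP[m mE].
have {mE} : (k * n + r = m * k + s)%N by lia.
move/(congr1 (modn^~ k)); rewrite mulnC !modnMDl !modn_small // => rsE.
by rewrite rsE eqxx in rs.
Qed.

Lemma dissection k (B : nat -> fps int) (F : nat -> int) r : (r < k)%N ->
    \fps_n (F n) = \sum_(s < k) q ^+ s * fps_subst 1 k (B s) ->
  \fps_n (F (k * n + r)%N) = B r.
Proof.
move=> rk FE; apply/fpsP => n.
rewrite -[LHS]/(fpscoef (\fps_n (F n)) (k * n + r)) FE fpscoef_sum.
rewrite (bigD1 (Ordinal rk)) // fpscoef_dissection // eqxx.
rewrite big1 => [|s]; first exact: addr0.
rewrite -val_eqE => sr.
by rewrite fpscoef_dissection // eq_sym (negbTE sr).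
Qed.

Lemma two_dissection (F : nat -> int) B0 B1 :
    \fps_n (F n) = fps_subst 1 2 B0 + q * fps_subst 1 2 B1 ->
  \fps_n (F (2 * n)%N) = B0 /\ \fps_n (F (2 * n + 1)%N) = B1.
Proof.
move=> FE; have {}FE : \fps_n (F n)
    = \sum_(s < 2) q ^+ s * fps_subst 1 2 (nth 0 [:: B0; B1] s).
  by rewrite FE !big_ord_recr big_ord0 /= add0r mul1r.
split; last exact: (dissection (r := 1) _ FE).
by rewrite -[RHS](dissection (r := 0) _ FE) //; apply/fpsP => n /=; rewrite addn0.
Qed.

Lemma three_dissection (F : nat -> int) B0 B1 B2 :
    \fps_n (F n) = fps_subst 1 3 B0 + q * fps_subst 1 3 B1
      + q ^+ 2 * fps_subst 1 3 B2 ->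
  [/\ \fps_n (F (3 * n)%N) = B0, \fps_n (F (3 * n + 1)%N) = B1
    & \fps_n (F (3 * n + 2)%N) = B2].
Proof.
move=> FE; have {}FE : \fps_n (F n)
    = \sum_(s < 3) q ^+ s * fps_subst 1 3 (nth 0 [:: B0; B1; B2] s).
  by rewrite FE !big_ord_recr big_ord0 /= add0r mul1r.
split; [|exact: (dissection (r := 1) _ FE)|exact: (dissection (r := 2) _ FE)].
by rewrite -[RHS](dissection (r := 0) _ FE) //; apply/fpsP => n /=; rewrite addn0.
Qed.

(** * Rescaled theta functions as eta quotients, and the final identities *)

Lemma fps_subst_div k (a b : fps int) : (0 < k)%N -> b \is a GRing.unit ->
  fps_subst 1 k (a / b) = fps_subst 1 k a / fps_subst 1 k b.
Proof. by case: k => // k _ bU; rewrite rmorph_div. Qed.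

Lemma phiN_scale k : (0 < k)%N -> fps_subst (-1) k phi = eta k ^+ 2 / eta (2 * k).
Proof.
move=> k0; have -> : fps_subst (-1) k phi = fps_subst 1 k phiN.
  by rewrite fps_subst_comp // mul1n mulr1.
rewrite phiN_eta fps_subst_div ?eta_unit //.
by case: k k0 => // k _; rewrite rmorphXn /= !eta_subst // muln1 mulnC.
Qed.

Lemma phi_scale k : (0 < k)%N ->
  fps_subst 1 k phi = eta (2 * k) ^+ 5 / (eta k ^+ 2 * eta (4 * k) ^+ 2).
Proof.
move=> k0; rewrite phi_eta fps_subst_div ?unitrM ?unitrX ?eta_unit //.
case: k k0 => // k _; rewrite !(rmorphXn, rmorphM) /= !eta_subst // muln1.
by rewrite ![(k.+1 * _)%N]mulnC.
Qed.

Lemma psi_scale k : (0 < k)%N -> fps_subst 1 k psi = eta (2 * k) ^+ 2 / eta k.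
Proof.
move=> k0; rewrite psi_eta fps_subst_div ?eta_unit //.
case: k k0 => // k _; rewrite rmorphXn /= !eta_subst // muln1.
by rewrite ![(k.+1 * _)%N]mulnC.
Qed.

(* Proves an identity of eta quotients in [eta a], ..., [eta g], not necessarily
   distinct, modulo the relations [eta k * (eta k)^-1 = 1]. *)
Local Ltac eta_field a b c d e f g :=
  rewrite -?exprVn ?invrM ?invrK ?unitrM ?unitrX ?unitrV ?eta_unit //;
  let ha := fresh in have ha := mulrV (eta_unit a);
  let hb := fresh in have hb := mulrV (eta_unit b);
  let hc := fresh in have hc := mulrV (eta_unit c);
  let hd := fresh in have hd := mulrV (eta_unit d);
  let he := fresh in have he := mulrV (eta_unit e);
  let hf := fresh in have hf := mulrV (eta_unit f);
  let hg := fresh in have hg := mulrV (eta_unit g);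
  ring: ha hb hc hd he hf hg.

(** [X] is [1 / (phi(-q^l) phi(-q)^2)] as an eta quotient; the generating function is
    [phi(q) X(q^2)], and only [phi(q)] needs dissecting. *)
Lemma pbar_generating2 l (X := eta (2 * l) * eta 2 ^+ 2 / (eta l ^+ 2 * eta 1 ^+ 4)) :
    (0 < l)%N ->
  \fps_n (pbar (2 * l) n)%:Z
    = fps_subst 1 2 (fps_subst 1 2 phi * X)
      + q * fps_subst 1 2 (2 * fps_subst 1 4 psi * X).
Proof.
move=> l0.
have -> : fps_subst 1 2 (fps_subst 1 2 phi * X)
    + q * fps_subst 1 2 (2 * fps_subst 1 4 psi * X) = phi * fps_subst 1 2 X.
  rewrite [in RHS]phi_dissection !rmorphM rmorph_nat /= !fps_subst_comp //.
  by rewrite !expr1n !mulr1; ring.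
rewrite pbar_generating ?muln_gt0 // /X fps_subst_div ?unitrM ?unitrX ?eta_unit //.
rewrite !(rmorphXn, rmorphM) /= !eta_subst ?muln_gt0 //.
by rewrite phi_eta; eta_field 1%N 2%N 4%N (2 * l)%N 1%N 1%N 1%N.
Qed.

(** [X(q^3)] is the inverse of [phi(-q^(3l))] times the norm evaluated in [phiN_norm]. *)
Lemma pbar_generating3 l
    (X := eta 2 ^+ 4 * eta 3 ^+ 2 * eta (2 * l) / (eta 1 ^+ 8 * eta 6 * eta l ^+ 2))
    (A := fps_subst (-1) 3 phi) :
    (0 < l)%N ->
  \fps_n (pbar (3 * l) n)%:Z
    = fps_subst 1 3 (A ^+ 2 * X) + q * fps_subst 1 3 (2 * A * omega * X)
      + q ^+ 2 * fps_subst 1 3 (4 * omega ^+ 2 * X).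
Proof.
move=> l0; have A3 : fps_subst 1 3 A = fps_subst 1 9 phiN.
  by rewrite /A !fps_subst_comp.
set a := fps_subst 1 9 phiN in A3; pose w := fps_subst 1 3 omega.
have -> : fps_subst 1 3 (A ^+ 2 * X) + q * fps_subst 1 3 (2 * A * omega * X)
      + q ^+ 2 * fps_subst 1 3 (4 * omega ^+ 2 * X)
    = (a ^+ 2 + 2 * q * a * w + 4 * q ^+ 2 * w ^+ 2) * fps_subst 1 3 X.
  rewrite /w -A3; move: (A) (omega) (X) => A' w' X'.
  by rewrite !(rmorphXn, rmorphM) /= !rmorph_nat; ring.
have phiN_unit : phiN \is a GRing.unit by apply: phi_subst_unit.
(* Multiplying by [phi(-q) = a - 2 q w] turns the quadratic factor into a difference of cubes, which
   is the norm. *)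
apply: (mulrI phiN_unit); rewrite mulrA.
have -> : phiN * (a ^+ 2 + 2 * q * a * w + 4 * q ^+ 2 * w ^+ 2)
    = a ^+ 3 - 8 * q ^+ 3 * w ^+ 3.
  by rewrite phiN_dissection -/a -/w; ring.
have U : eta 6 ^+ 4 * eta 9 ^+ 2 \is a GRing.unit by rewrite unitrM !unitrX ?eta_unit.
rewrite -[a ^+ 3 - _](mulrK U) phiN_norm.
rewrite pbar_generating ?muln_gt0 // /X fps_subst_div ?unitrM ?unitrX ?eta_unit //.
rewrite !(rmorphXn, rmorphM) /= !eta_subst ?muln_gt0 // phiN_eta.
rewrite [(2 * (3 * l))%N]mulnCA.
eta_field 1%N 2%N 3%N 6%N 9%N 18%N (3 * l)%N.
Qed.

Theorem theorem3p1 (l : nat) (hl : (1 <= l)%N) :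
  [/\ \fps_n (pbar (2 * l) (2 * n))%:Z
        = eta (2 * l) * eta 4 ^+ 5 / (eta l ^+ 2 * eta 1 ^+ 4 * eta 8 ^+ 2)
      /\ eta (2 * l) * eta 4 ^+ 5 / (eta l ^+ 2 * eta 1 ^+ 4 * eta 8 ^+ 2)
        = fps_subst 1 2 phi / (fps_subst (-1) l phi * fps_subst (-1) 1 phi ^+ 2),
      \fps_n (pbar (2 * l) (2 * n + 1))%:Z
        = 2 * (eta (2 * l) * eta 2 ^+ 2 * eta 8 ^+ 2
               / (eta l ^+ 2 * eta 1 ^+ 4 * eta 4))
      /\ 2 * (eta (2 * l) * eta 2 ^+ 2 * eta 8 ^+ 2
               / (eta l ^+ 2 * eta 1 ^+ 4 * eta 4))
        = 2 * (fps_subst 1 4 psi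
               / (fps_subst (-1) l phi * fps_subst (-1) 1 phi ^+ 2)),
      \fps_n (pbar (3 * l) (3 * n))%:Z
        = eta (2 * l) * eta 2 ^+ 4 * eta 3 ^+ 6
          / (eta l ^+ 2 * eta 1 ^+ 8 * eta 6 ^+ 3)
      /\ eta (2 * l) * eta 2 ^+ 4 * eta 3 ^+ 6
          / (eta l ^+ 2 * eta 1 ^+ 8 * eta 6 ^+ 3)
        = fps_subst (-1) 3 phi ^+ 3
          / (fps_subst (-1) l phi * fps_subst (-1) 1 phi ^+ 4),
      \fps_n (pbar (3 * l) (3 * n + 1))%:Z
        = 2 * (eta (2 * l) * eta 2 ^+ 3 * eta 3 ^+ 3
               / (eta l ^+ 2 * eta 1 ^+ 7))
    & \fps_n (pbar (3 * l) (3 * n + 2))%:Z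
        = 4 * (eta (2 * l) * eta 2 ^+ 2 * eta 6 ^+ 3
               / (eta l ^+ 2 * eta 1 ^+ 6))].
Proof.
have [-> ->] := two_dissection (pbar_generating2 hl).
have [-> -> ->] := three_dissection (pbar_generating3 hl).
(* The components are now explicit; once the theta functions and [omega] are eta quotients, only
   cancellations of units remain. *)
rewrite !phiN_scale // !phi_scale // !psi_scale // /omega.
split; first split.
- by eta_field 1%N 2%N 4%N l 8%N (2 * l)%N 1%N.
- by eta_field 1%N 2%N 4%N l 8%N (2 * l)%N 1%N.
- split.
  + by eta_field 1%N 2%N 4%N l 8%N (2 * l)%N 1%N.
  + by eta_field 1%N 2%N 4%N l 8%N (2 * l)%N 1%N.
- split.
  + by eta_field 1%N 2%N 3%N 6%N l 1%N 1%N.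
  + by eta_field 1%N 2%N 3%N 6%N l (2 * l)%N 1%N.
- by eta_field 1%N 2%N 3%N 6%N l 1%N 1%N.
- by eta_field 1%N 2%N 3%N 6%N l 1%N 1%N.
Qed.
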